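(* The fractional part function $x\mapsto\{x\}$ is the only function $f:\mathbb{R}\rightarrow\mathbb{R}$ satisfying the decomposer equation $$f(f^*(x)+f(y))=f(y)\quad\text{for all }x,y\in\mathbb{R}$$ together with the conditions: (i) $f(\mathbb{R})=[0,1)$; (ii) $f^*(\mathbb{R})\cap\mathbb{Z}\neq\emptyset$. Moreover, the functions $f:\mathbb{R}\to\mathbb{R}$ satisfying the decomposer equation and condition (i) are exactly the functions of the form $f(x)=\{x-c\}$, where $c$ is an arbitrary real constant.
   Context: For $f:\mathbb{R}\to\mathbb{R}$, the function $f^*:\mathbb{R}\to\mathbb{R}$ is defined by $f^*(x)=x-f(x)$. $\{x\}=x-\lfloor x\rfloor$ is the fractional part of the real number $x$, where $\lfloor x\rfloor$ is the greatest integer less than or equal to $x$. $f(\mathbb{R})$ and $f^*(\mathbb{R})$ denote the ranges of $f$ and $f^*$. *)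

(* Defs.v *)
(* The real line is rendered as an arbitrary [R : realType]. *)
From mathcomp Require Import all_boot all_order all_algebra.
From mathcomp Require Import boolp classical_sets set_interval reals.

Set Implicit Arguments.
Unset Strict Implicit.
Unset Printing Implicit Defensive.

Import Order.TTheory GRing.Theory Num.Theory.

Local Open Scope classical_set_scope.
Local Open Scope ring_scope.

Definition frac_part (R : realType) (x : R) : R := x - (Num.floor x)%:~R.

Definition fstar (R : realType) (f : R -> R) (x : R) : R := x - f x.

Definition decomposer (R : realType) (f : R -> R) : Prop :=
  forall x y : R, f (fstar f x + f y) = f y.

(* Main.v *)
Require Import Defs.
From mathcomp Require Import all_boot all_order all_algebra.
From mathcomp Require Import boolp classical_sets set_interval reals.
From mathcomp Require Import ring lra.

Set Implicit Arguments.
Unset Strict Implicit.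
Unset Printing Implicit Defensive.

Import Order.TTheory GRing.Theory Num.Theory.

Local Open Scope classical_set_scope.
Local Open Scope ring_scope.

(** With A = range (fstar f), the equation and range f = [0, 1[ say that
    f (a + s) = s for all a in A and s in [0, 1[, so the intervals [a, a + 1[
    (a in A) tile the line. Two elements of A less than 1 apart coincide, hence
    A is stable under translation by 1 and -1, and contains c + n for every
    integer n as soon as it contains c. *)

Lemma frac_partE (R : realType) (n : int) (s : R) :
  0 <= s < 1 -> frac_part (n%:~R + s) = s.
Proof.
move=> /andP[s0 s1]; rewrite /frac_part (@floor_def _ _ n); first by ring.
by rewrite intrD lerDl s0 ltrD2l.
Qed.

Lemma frac_part_itv (R : realType) (x : R) : 0 <= frac_part x < 1.
Proof.
by have /andP[] := floor_itv x; rewrite intrD /frac_part subr_ge0 ltrBlDl => -> ->.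
Qed.

Lemma range_frac_partB (R : realType) (c : R) :
  range (fun x => frac_part (x - c)) = `[0, 1[%classic.
Proof.
apply/seteqP; split => [_ [x _ <-]|s /=]; rewrite /= in_itv /=.
  exact: frac_part_itv.
move=> s01; exists (c + s) => //.
by rewrite [c + s]addrC addrK -[s in LHS]add0r (frac_partE 0).
Qed.

Lemma decomposer_frac_partB (R : realType) (c : R) :
  decomposer (fun x => frac_part (x - c)).
Proof.
(* Since [fstar] sends [x] to [c] plus the floor of [x - c], the argument of [f] exceeds [c] by that
   integer plus the fractional part of [y - c]. *)
move=> x y; rewrite -[RHS](frac_partE (Num.floor (x - c)) (frac_part_itv _)).
by congr frac_part; rewrite /fstar {1}/frac_part; ring.
Qed.

Section Decomposer.
Variables (R : realType) (f : R -> R).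
Hypotheses (f_dec : decomposer f) (f_range : range f = `[0, 1[%classic).

Lemma decomposer_itv x : 0 <= f x < 1.
Proof.
have : range f (f x) by exists x.
by rewrite f_range /= in_itv.
Qed.

Lemma decomposerD a s : range (fstar f) a -> 0 <= s < 1 -> f (a + s) = s.
Proof.
move=> [x _ <-] s01; have [y _ <-] : range f s by rewrite f_range /= in_itv.
exact: f_dec.
Qed.

(** The point [b] lies in two tiles: as the left end of its own it gives [f b = 0], and as a point
    of the tile at [a] it gives [f b = b - a]. *)
Lemma range_fstar_inj a b : range (fstar f) a -> range (fstar f) b ->
  a <= b < a + 1 -> b = a.
Proof.
move=> Aa Ab /andP[ab ba].
have fb0 : f b = 0 by rewrite -[b]addr0 decomposerD// lexx ltr01.
have : f (a + (b - a)) = b - a by apply: decomposerD => //; lra.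
by rewrite addrC subrK fb0; lra.
Qed.

Lemma range_fstarD1 a : range (fstar f) a -> range (fstar f) (a + 1).
Proof.
move=> Aa; have Ab : range (fstar f) (fstar f (a + 1)) by exists (a + 1).
have /andP[f0 f1] := decomposer_itv (a + 1).
have [f_eq0|f_neq0] := eqVneq (f (a + 1)) 0.
  by move: Ab; rewrite [fstar f (a + 1)]/fstar f_eq0 subr0.
have fgt0 : 0 < f (a + 1) by rewrite lt_neqAle eq_sym f_neq0.
(* The tile containing [a + 1] would start strictly between [a] and [a + 1], hence at [a] itself;
   this forces [f (a + 1) = 1], which is excluded. *)
have : fstar f (a + 1) = a by apply: range_fstar_inj => //; rewrite /fstar; lra.
by rewrite /fstar; lra.
Qed.

Lemma range_fstarB1 a : range (fstar f) a -> range (fstar f) (a - 1).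
Proof.
move=> Aa; have Ab : range (fstar f) (fstar f (a - 1)) by exists (a - 1).
have /andP[f0 f1] := decomposer_itv (a - 1).
(* The tile containing [a - 1] starts in []a - 2, a - 1]], so its successor starts in []a - 1, a]],
   too close to [a] to differ from it. *)
have : a = fstar f (a - 1) + 1.
  apply: range_fstar_inj => //; first exact: range_fstarD1.
  by rewrite /fstar; lra.
by move=> a_eq; rewrite a_eq addrK.
Qed.

Lemma range_fstarDz a (n : int) :
  range (fstar f) a -> range (fstar f) (a + n%:~R).
Proof.
move=> Aa; elim/int_rec: n => [|n IHn|n IHn]; first by rewrite addr0.
  by rewrite -addn1 PoszD intrD addrA; exact: range_fstarD1.
by rewrite -addn1 PoszD opprD intrD addrA; exact: range_fstarB1.
Qed.

(** Split [x] as [a] plus the floor of [x - a], which is again a left end of a tile, plus a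
    remainder in [[0, 1[]; [f] returns that remainder. *)
Lemma decomposer_frac_part a : range (fstar f) a ->
  f = (fun x => frac_part (x - a)).
Proof.
move=> Aa; apply/funext => x.
rewrite -[RHS](decomposerD (range_fstarDz (Num.floor (x - a)) Aa))//.
  by congr f; rewrite /frac_part; ring.
exact: frac_part_itv.
Qed.

End Decomposer.

Theorem corollary2p5 (R : realType) :
  (forall f : R -> R,
      [/\ decomposer f,
          range f = `[0, 1[%classic
        & range (fstar f) `&` [set z : R | z \is a Num.int] !=set0]
      <-> f = @frac_part R)
  /\
  (forall f : R -> R,
      (decomposer f /\ range f = `[0, 1[%classic)
      <-> exists c : R, f = (fun x => frac_part (x - c))).
Proof.
have frac0 : @frac_part R = (fun x => frac_part (x - 0)).
  by apply/funext => x; rewrite subr0.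
split=> f; split.
- move=> [f_dec f_range [z [Az /= /intrP[n z_n]]]].
  rewrite z_n in Az; rewrite frac0; apply: decomposer_frac_part => //.
  (* Translating the integer point [n] of the range by [-n] puts 0 in it, so the constant may be
     taken to be 0. *)
  by rewrite -(subrr n%:~R) -mulrNz; exact: range_fstarDz.
- move=> ->; split.
  + by rewrite frac0; exact: decomposer_frac_partB.
  + by rewrite frac0; exact: range_frac_partB.
  (* This is the value of [fstar] at 0, left unevaluated. *)
  + exists (Num.floor (0 : R))%:~R; split => /=; last exact: intr_int.
    by exists 0 => //; rewrite /fstar /frac_part subKr.
- move=> [f_dec f_range]; exists (fstar f 0).
  by apply: decomposer_frac_part => //; exists 0.
- move=> [c ->]; split.
  + exact: decomposer_frac_partB.
  + exact: range_frac_partB.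
Qed.
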